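(* Let $(X,r)$ be an indecomposable solution of size $|X|=pq$, where $p\neq q$ are prime numbers. Then the $T$-partition of $(X,r)$ cannot contain a term $s$ satisfying $(p-1)q<s<pq$ and $\gcd(s,p)=1$.
   Context: A solution $(X,r)$ is a non-empty finite set $X$, with $|X|>1$, together with an involutive map $r\colon X\times X\to X\times X$, $r(x,y)=(\sigma_x(y),\tau_y(x))$, satisfying $r_1r_2r_1=r_2r_1r_2$ on $X^3$, where $r_1=r\times \mathrm{Id}_X$ and $r_2=\mathrm{Id}_X\times r$, and such that all maps $\sigma_x$ and $\tau_x$ ($x\in X$) are bijections of $X$. A solution is decomposable if $X=Y\sqcup Z$ with $Y,Z$ non-empty and disjoint, $r(Y\times Y)=Y\times Y$ and $r(Z\times Z)=Z\times Z$; equivalently, if the permutation group $\mathcal{G}(X,r)$ generated by all $\sigma_x$, $x\in X$, does not act transitively on $X$. Otherwise it is indecomposable. The diagonal map of $(X,r)$ is the permutation $T\colon X\to X$, $T(x)=\tau_x^{-1}(x)$. The $T$-partition of $(X,r)$ is the partition of the integer $|X|$ given by the multiset of sizes of the $T$-orbits in $X$ (fixed points counted as orbits of size $1$). *)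

(* Defs.v *)
From HB Require Import structures.
From mathcomp Require Import all_boot all_order all_fingroup.

Set Implicit Arguments.
Unset Strict Implicit.
Unset Printing Implicit Defensive.

Section SolutionDefs.

Variables (X : finType) (r : X * X -> X * X).

(** [r (x, y) = (sigma x y, tau y x)]: the first argument of [tau] is the
    second component of the pair. *)
Definition sigma (x y : X) : X := (r (x, y)).1.
Definition tau (y x : X) : X := (r (x, y)).2.

(** [X^3] is encoded as [X * X * X]. *)
Definition r1 (t : X * X * X) : X * X * X :=
  let: (x, y, z) := t in (r (x, y), z).
Definition r2 (t : X * X * X) : X * X * X :=
  let: (x, y, z) := t in (x, (r (y, z)).1, (r (y, z)).2).

Definition braided : Prop := forall t, r1 (r2 (r1 t)) = r2 (r1 (r2 t)).

Definition decomposable : Prop :=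
  exists Y Z : {set X},
    [/\ Y != set0, Z != set0, [disjoint Y & Z] & Y :|: Z = setT] /\
    (r @: setX Y Y = setX Y Y /\ r @: setX Z Z = setX Z Z).

Definition indecomposable : Prop := ~ decomposable.

End SolutionDefs.

Record solution (X : finType) := Solution {
  sol_map :> X * X -> X * X;
  sol_card_gt1 : 1 < #|X|;
  sol_involutive : involutive sol_map;
  sol_braided : braided sol_map;
  sol_sigma_bij : forall x, bijective (sigma sol_map x);
  sol_tau_bij : forall x, bijective (tau sol_map x)
}.

Section DiagonalMap.

Variables (X : finType) (r : solution X).

Definition diag_fun (x : X) : X := invF (bij_inj (sol_tau_bij r x)) x.

Lemma diag_fun_inj : injective diag_fun.
Proof.
suff sigmaT x : sigma r (diag_fun x) x = diag_fun x.
  move=> x y eqT; apply: (bij_inj (sol_sigma_bij r (diag_fun x))).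
  by rewrite sigmaT eqT sigmaT.
have tauT : tau r x (diag_fun x) = x by apply: f_invF.
have rT : r (diag_fun x, x) = (sigma r (diag_fun x) x, x).
  by rewrite [LHS]surjective_pairing; congr pair.
apply: (bij_inj (sol_tau_bij r x)).
by rewrite tauT /tau -rT sol_involutive.
Qed.

Definition diag_map : {perm X} := perm diag_fun_inj.

(** The multiset of orbit sizes, as a non-increasing sequence; [porbits]
    includes the singleton orbits of fixed points. *)
Definition T_partition : seq nat :=
  sort geq [seq #|A| | A : {set X} <- enum (porbits diag_map)].

End DiagonalMap.

(* Main.v *)
Require Import Defs.
From mathcomp Require Import all_boot all_order all_fingroup.
From mathcomp Require Import all_solvable all_character.

(** The length of every T-orbit is divisible by [p] or by [q]
    ([diag_orbit_not_coprime]). A term [s] prime to [p] is therefore a multiple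
    of [q], and no multiple of [q] lies strictly between [(p - 1) * q] and
    [p * q].

    Let [rho x] be the inverse of [sigma x], and [G] the group generated by all
    [rho x]; it is transitive, and the inverse of T is [x |-> rho x x]. The group
    [G] carries a second, abelian, group law which makes it a left brace. Here
    that law is a regular abelian group [A] of permutations of the set [G],
    normalised by the left translations of [G]. It is generated by one element
    [a_x] for each point [x], with three properties: [a |-> a 1] is a bijection
    from [A] to [G], conjugation by the left translation of [h] turns [a_x] into
    [a_(h x)], and [(a_x ^+ n) 1] acts on the point [x] as the inverse of T
    iterated [n] times.

    Let [pi] be the set of primes dividing [#|X|], and suppose that the T-orbit
    of [x] has length [n] prime to [#|X|]. The [pi]-part of [a_x] is a power of
    [a_x ^+ n], so its image in [G] fixes [x]. As left translations normalise
    the characteristic subgroups of [A], the [pi]-part of [A] maps onto a Hall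
    [pi]-subgroup of [G], and this subgroup is still transitive. So it is enough
    to contradict the existence of such a fixed point when [G] is a
    [pi]-group ([at1_no_fixpoint]).

    In that case [G] is solvable by Burnside's theorem, hence has a nontrivial
    normal subgroup ['O_p(G)] for one of the two primes, called [p] from here on;
    let [m] be the other one. The orbits of ['O_p(G)] are [m] blocks of size [p].
    The Sylow [p]-subgroup [L] of [G] that comes from [A] fixes every block
    ([LK] below): this is clear if [p > m], and if [p < m] it follows because [L]
    turns out to be normal. Thus [G] acts on the [m] blocks as an [m]-group, and
    an element that fixes one block lies in the kernel [K] of this action. The
    preimage of [K] in [A] is a subgroup stable under conjugation by left
    translations. If [t x], the generator attached to [x], maps to an
    element fixing [x], it lies in this preimage, and so do all its conjugates
    [t y]; they generate [A], so that [K = G], although [G] permutes the [m]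
    blocks transitively. *)

Set Implicit Arguments.
Unset Strict Implicit.
Unset Printing Implicit Defensive.
Import GroupScope.

(** * Actions of p-groups on few points *)

Lemma small_pnat (p n : nat) : p.-nat n -> n < p -> n = 1%N.
Proof.
move=> pn ltnp; have n_gt0 : 0 < n by case/andP: pn.
apply/eqP; rewrite eqn_leq n_gt0 andbT leqNgt; apply/negP=> n_gt1.
have := pnatPpi pn (_ : pdiv n \in \pi(n)); rewrite pi_pdiv => /(_ n_gt1).
by move/eqP=> def_p; have := pdiv_leq n_gt0; rewrite def_p leqNgt ltnp.
Qed.

Lemma pgroup_small_orbit (aT : finGroupType) (rT : finType)
    (to : {action aT &-> rT}) (p : nat) (H : {group aT}) (c : rT) :
  p.-group H -> #|orbit to H c| < p -> {in H, forall h, to c h = c}.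
Proof.
move=> pH lt_p h Hh.
have p_orb : p.-nat #|orbit to H c| by rewrite (pnat_dvd (dvdn_orbit _ _ _)).
have /eqP/cards1P[d def_orb] := small_pnat p_orb lt_p.
have := orbit_refl to H c; rewrite def_orb inE => /eqP def_d.
by have := mem_orbit to c Hh; rewrite def_orb inE -def_d => /eqP.
Qed.

(** For [#|S| = p] this is the regularity of a transitive p-group of degree [p]:
    the orbits of [<[h]>] other than [b] have fewer than [p] points. *)
Lemma pgroup_fix_point (aT : finGroupType) (rT : finType)
    (to : {action aT &-> rT}) (p : nat) (H : {group aT}) (S : {set rT})
    (h : aT) (b : rT) :
    p.-group H -> H \subset 'N(S | to) -> #|S| <= p -> h \in H -> b \in S ->
    to b h = b ->
  {in S, forall c, to c h = c}.
Proof.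
move=> pH actsH leSp Hh Sb fixb c Sc.
have [-> // | neq_cb] := eqVneq c b.
have sHh : <[h]> \subset H by rewrite cycle_subG.
apply: (@pgroup_small_orbit _ _ _ p <[h]>%G); rewrite ?cycle_id ?(pgroupS sHh) //.
apply: leq_trans leSp; apply/proper_card/properP; split.
  by rewrite acts_sub_orbit // (subset_trans sHh).
exists b => //; apply: contra neq_cb => /orbitP[k hk def_b].
have fixbk : to b k = b.
  by have /cycleP[i ->] := hk; elim: i => [|i IHi]; rewrite ?act1 // expgSr actM IHi.
by apply/eqP/(act_inj to k); rewrite def_b fixbk.
Qed.

(** * Orbits of a normal subgroup *)

Lemma dvdn_orbit_stab (aT : finGroupType) (rT rT' : finType)
    (to : {action aT &-> rT}) (to' : {action aT &-> rT'}) (G : {group aT}) x y :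
    {in G, forall g, to' y g = y -> to x g = x} ->
  #|orbit to G x| %| #|orbit to' G y|.
Proof.
move=> fix_xy; rewrite !card_orbit; apply: indexgS.
apply/subsetP=> g /setIP[Gg /astab1P fix_y].
by apply/setIP; split=> //; apply/astab1P/fix_xy.
Qed.

Section NormalOrbits.
Variables (aT : finGroupType) (rT : finType) (to : {action aT &-> rT}).
Variables (G N : {group aT}).
Hypothesis nNG : N <| G.

Lemma setact_orbit_normal g x : g \in G -> to^*%act (orbit to N x) g = orbit to N (to x g).
Proof.
move=> Gg; apply/setP=> y.
have nN : N :^ g = N by apply: normsP Gg; case/andP: nNG.
rewrite -{2}[y](actKV to g) -{2}nN orbit_conjsg /= setactE.
apply/imsetP/idP=> [[z Nxz ->] | Nxy]; first by rewrite actK.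
by exists (to y g^-1); rewrite ?actKV.
Qed.

Lemma acts_normal_orbits : G \subset 'N((orbit to N @: setT) | to^*).
Proof.
apply/actsP=> g Gg B; apply/imsetP/imsetP=> [[x _ defB] | [x _ ->]]; last first.
  by exists (to x g); rewrite ?setact_orbit_normal.
exists (to x g^-1); rewrite ?inE // -setact_orbit_normal ?groupV // -defB.
by rewrite actK.
Qed.

Lemma atrans_normal_orbits : [transitive G, on setT | to] ->
  [transitive G, on (orbit to N @: setT) | to^*].
Proof.
move=> trG; have [x0 _ _] := imsetP trG.
apply/imsetP; exists (orbit to N x0); first exact: imset_f.
apply/setP=> B; apply/imsetP/orbitP=> [[x _ ->] | [g Gg <-]].
  have /(atransP2 trG) := in_setT x0 => /(_ x (in_setT x))[g Gg ->].
  by exists g; rewrite ?setact_orbit_normal.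
by exists (to x0 g); rewrite ?setact_orbit_normal.
Qed.

Lemma card_normal_orbit : [transitive G, on setT | to] ->
  forall x, #|rT| = (#|(orbit to N @: setT)| * #|orbit to N x|)%N.
Proof.
move=> trG x.
have part : partition (orbit to N @: setT) [set: rT].
  have /orbit_partition : N \subset 'N(setT | to) by apply/actsP=> ? _ ?; rewrite !inE.
  exact.
rewrite -cardsT (card_uniform_partition (n := #|orbit to N x|) _ part) //.
move=> _ /imsetP[y _ ->].
have [g Gg ->] := atransP2 trG (in_setT x) (in_setT y).
by rewrite -setact_orbit_normal //= card_setact.
Qed.

End NormalOrbits.

(** * Braces as regular permutation groups *)

Section Brace.
Variable gT : finGroupType.
Implicit Types (a b c : {perm gT}) (g h k : gT) (A : {group {perm gT}}) (G : {group gT}).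

(** The translation is by the inverse of [h], so that [lmul] is a morphism for
    the product of permutations, in which the left factor acts first. *)
Definition lmul h : {perm gT} := perm (@mulgI gT h^-1).

Lemma lmulE h g : lmul h g = h^-1 * g. Proof. exact: permE. Qed.

Lemma lmulM : {morph lmul : h k / h * k}.
Proof. by move=> h k; apply/permP=> g; rewrite permM !lmulE invMg mulgA. Qed.

Lemma lmulV h : lmul h^-1 = (lmul h)^-1.
Proof.
apply/(mulgI (lmul h)); rewrite -lmulM !mulgV.
by apply/permP=> g; rewrite lmulE perm1 invg1 mul1g.
Qed.

Lemma conj_lmulE a h g : (a ^ lmul h) g = h^-1 * a (h * g).
Proof. by rewrite conjgE -lmulV !permM !lmulE invgK. Qed.

(** The map [a |-> a 1] is a 1-cocycle for the conjugation action of [lmul]. This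
    is what links the group law of [gT] to that of [{perm gT}]. *)
Lemma mul_at1 a b : (a * b) 1 = a 1 * (b ^ lmul (a 1)) 1.
Proof. by rewrite permM conj_lmulE mulg1 mulKVg. Qed.

Lemma at1_mul a b : a 1 * b 1 = (a * b ^ (lmul (a 1))^-1) 1.
Proof. by rewrite mul_at1 conjgKV. Qed.

(** A left brace with multiplicative group [G]: its additive group is transported
    to the permutation group [A] of the translations [g |-> g + a], which is
    regular on [G], and [a 1] is the element of [G] that [a] represents. The last
    condition says that the lambda-action of [G] is by automorphisms. *)
Definition brace_pair A G : Prop :=
  [/\ abelian A, {in A &, injective (fun a => a 1)}, [set a 1 | a : {perm gT} in A] = G
    & {in G, forall h, lmul h \in 'N(A)}].

(** The image in [G] of the [pi]-part of the additive group. That image is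
    already a group ([brace_partE]); [<<_>>] only serves to make it one by
    construction. *)
Definition brace_part (pi : nat_pred) A : {group gT} :=
  <<[set a 1 | a : {perm gT} in 'O_pi(A)]%g>>%G.

Section Pair.
Variables (A : {group {perm gT}}) (G : {group gT}).
Hypothesis bAG : brace_pair A G.

Let cAA : abelian A. Proof. by case: bAG. Qed.
Let injA : {in A &, injective (fun a => a 1)}. Proof. by case: bAG. Qed.
Let nAG h : h \in G -> lmul h \in 'N(A).
Proof. by case: bAG => _ _ _; apply. Qed.

Lemma brace_at1 a : a \in A -> a 1 \in G.
Proof. by case: bAG => _ _ <- _ Aa; apply: imset_f. Qed.

Lemma brace_at1P g : g \in G -> exists2 a, a \in A & g = a 1.
Proof. by case: bAG => _ _ <- _ /imsetP. Qed.

Lemma brace_conj a h : h \in G -> (a ^ lmul h \in A) = (a \in A).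
Proof. by move=> Gh; rewrite memJ_norm ?nAG. Qed.

Lemma brace_conjV a h : h \in G -> (a ^ (lmul h)^-1 \in A) = (a \in A).
Proof. by move=> Gh; rewrite -lmulV brace_conj ?groupV. Qed.

Lemma mem_brace_pcore pi a : (a \in 'O_pi(A)) = (a \in A) && pi.-elt a.
Proof.
apply/idP/andP=> [Oa | [Aa pi_a]].
  by split; [apply: subsetP Oa; apply: pcore_sub | apply: mem_p_elt Oa; apply: pcore_pgroup].
by rewrite (mem_normal_Hall (nilpotent_pcore_Hall _ (abelian_nil cAA)) (pcore_normal _ _)).
Qed.

Lemma constt_brace pi a : a \in A -> a.`_pi \in 'O_pi(A).
Proof. by move=> Aa; rewrite mem_brace_pcore groupX // p_elt_constt. Qed.

Lemma constt_braceM pi a b : a \in A -> b \in A ->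
  (a * b).`_pi = a.`_pi * b.`_pi.
Proof. by move=> Aa Ab; rewrite consttM //; apply: (centsP cAA). Qed.

(** The [pi]-part of an abelian group is characteristic, hence stable under the
    lambda-action, and the cocycle identity makes its image multiplicative. *)
Lemma brace_partE pi :
  brace_part pi A = [set a 1 | a : {perm gT} in 'O_pi(A)] :> {set gT}.
Proof.
rewrite /= gen_set_id //; apply/group_setP; split.
  by apply/imsetP; exists 1; rewrite ?group1 ?perm1.
move=> _ _ /imsetP[a Oa ->] /imsetP[b Ob ->]; rewrite at1_mul.
apply: imset_f; apply: (groupM Oa); move: Oa Ob.
rewrite !mem_brace_pcore => /andP[Aa _] /andP[Ab pi_b].
by rewrite brace_conjV ?brace_at1 // Ab p_eltJ.
Qed.

Lemma brace_part_pair pi : brace_pair ('O_pi(A))%G (brace_part pi A).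
Proof.
have sOA : 'O_pi(A) \subset A by apply: pcore_sub.
split; rewrite ?brace_partE //; first exact: abelianS cAA.
  by move=> a b Oa Ob; apply: injA; apply: (subsetP sOA).
move=> _ /imsetP[a Oa ->].
by apply/(subsetP (gFnorms _ _))/nAG/brace_at1/(subsetP sOA).
Qed.

Lemma brace_part_Hall pi : pi.-Hall(G) (brace_part pi A).
Proof.
have sOA : 'O_pi(A) \subset A by apply: pcore_sub.
have oG : #|G| = #|A|.
  by have [_ _ <- _] := bAG; rewrite card_in_imset.
have oP : #|brace_part pi A| = #|'O_pi(A)|.
  by rewrite brace_partE card_in_imset // => a b Oa Ob; apply: injA; apply: (subsetP sOA).
rewrite pHallE oP oG (card_Hall (nilpotent_pcore_Hall _ (abelian_nil cAA))) eqxx andbT.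
by rewrite brace_partE; apply/subsetP=> _ /imsetP[a Oa ->]; apply/brace_at1/(subsetP sOA).
Qed.

Lemma mem_brace_part pi a : a \in A -> (a 1 \in brace_part pi A) = (a \in 'O_pi(A)).
Proof.
move=> Aa; rewrite brace_partE; apply/imsetP/idP=> [[b Ob /injA-> //] | Oa].
  exact: (subsetP (pcore_sub pi A)).
by exists a.
Qed.

(** Left cosets of the [pi]-part of [G] are represented by [pi^']-components: apply
    [mul_at1] to the decomposition of [a] into its constituents. *)
Lemma brace_at1_constt pi a : a \in A ->
  exists2 g, g \in brace_part pi A & a 1 = a.`_pi^' 1 * g.
Proof.
move=> Aa; set b := a.`_pi^'; have Ab : b \in A by rewrite groupX.
exists ((a.`_pi ^ lmul (b 1)) 1); last by rewrite -mul_at1 -{1}(consttC pi^' a) consttNK.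
rewrite mem_brace_part ?brace_conj ?brace_at1 ?groupX // mem_brace_pcore.
by rewrite brace_conj ?brace_at1 ?groupX // p_eltJ p_elt_constt.
Qed.

Lemma brace_constt_mul pi a b c : a \in A -> b \in A -> c \in A ->
  a 1 * b 1 = c 1 -> c.`_pi = a.`_pi * b.`_pi ^ (lmul (a 1))^-1.
Proof.
move=> Aa Ab Ac; have Ab' : b ^ (lmul (a 1))^-1 \in A by rewrite brace_conjV ?brace_at1.
rewrite at1_mul => /(injA (groupM Aa Ab') Ac) <-.
by rewrite constt_braceM // consttJ.
Qed.

(** Expand [a * c = c * a], where [c] represents [g], in both orders. By normality
    of [N], the elements of [G] represented by [a ^ lmul g] and by [a] lie in the
    same left coset of the [pi]-part of [G]; as both belong to the [pi^']-part,
    they coincide. *)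
Lemma normal_pgroup_fixes_brace pi (N : {group gT}) g a :
  N <| G -> N \subset brace_part pi A -> g \in N -> a \in 'O_pi^'(A) ->
  a ^ lmul g = a.
Proof.
move=> /andP[sNG nNG] sNL Ng Oa; have Gg := subsetP sNG g Ng.
have Aa : a \in A by move: Oa; rewrite mem_brace_pcore => /andP[].
have [c Ac def_g] := brace_at1P Gg.
have Lc : c 1 \in brace_part pi A by rewrite -def_g (subsetP sNL).
have Oc : c \in 'O_pi(A) by rewrite -mem_brace_part.
have Gaf : (a ^ lmul g) 1 \in brace_part pi^' A.
  rewrite mem_brace_part ?brace_conj // mem_brace_pcore brace_conj // Aa p_eltJ.
  by move: Oa; rewrite mem_brace_pcore Aa.
have Ga1 : a 1 \in brace_part pi^' A by rewrite mem_brace_part.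
have L1 : (c ^ lmul (a 1)) 1 \in brace_part pi A.
  rewrite mem_brace_part ?brace_conj ?brace_at1 // mem_brace_pcore.
  rewrite brace_conj ?brace_at1 // Ac p_eltJ.
  by move: Oc; rewrite mem_brace_pcore Ac.
have eq1 : g * (a ^ lmul g) 1 = a 1 * (c ^ lmul (a 1)) 1.
  by rewrite def_g -!mul_at1 (centsP cAA a Aa c Ac).
apply: injA; rewrite ?brace_conj //.
have TI : brace_part pi A :&: brace_part pi^' A = 1.
  apply: coprime_TIg; apply: (@pnat_coprime pi).
    exact: pHall_pgroup (brace_part_Hall pi).
  exact: pHall_pgroup (brace_part_Hall pi^').
apply/esym/eqP; rewrite eq_mulVg1 -cycle_eq1 -subG1 -TI cycle_subG inE.
rewrite [X in _ && X]groupM ?groupV // andbT.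
have -> : (a 1)^-1 * (a ^ lmul g) 1 = (g^-1) ^ (a 1) * (c ^ lmul (a 1)) 1.
  by rewrite conjgE -!mulgA -eq1 mulKg.
rewrite groupM // (subsetP sNL) // memJ_norm ?groupV //.
by rewrite (subsetP nNG) // brace_at1.
Qed.

(** Taking constituents is a morphism on an abelian group, so membership of
    constituents in a subgroup can be tested on generators. *)
Lemma constt_gen (I : finType) (t : I -> {perm gT}) pi (H : {group {perm gT}}) :
    A :=: <<[set t i | i : I]>> -> (forall i, (t i).`_pi \in H) ->
  {in A, forall a, a.`_pi \in H}.
Proof.
move=> defA Ht a Aa; pose W := [set b in A | b.`_pi \in H].
have gW : group_set W.
  apply/group_setP; split; first by rewrite inE group1 constt1 group1.
  move=> b c; rewrite !inE => /andP[Ab Hb] /andP[Ac Hc].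
  by rewrite groupM // constt_braceM // groupM.
suff /subsetP/(_ a) : <<[set t i | i : I]>> \subset Group gW.
  by rewrite -defA inE => /(_ Aa) /andP[].
rewrite gen_subG; apply/subsetP=> _ /imsetP[i _ ->].
by rewrite inE Ht defA mem_gen // imset_f.
Qed.

Lemma constt_fixes_gen (I : finType) (t : I -> {perm gT}) pi h :
    A :=: <<[set t i | i : I]>> ->
    (forall i, (t i).`_pi ^ lmul h = (t i).`_pi) ->
  {in A, forall a, a.`_pi ^ lmul h = a.`_pi}.
Proof.
move=> defA fix_t a Aa.
have cent1J (b : {perm gT}) : reflect (b ^ lmul h = b) (b \in 'C[lmul h]).
  exact: equivP cent1P (iff_trans (rwP commgP) (iff_sym (rwP conjg_fixP))).
by apply/cent1J; apply: (constt_gen defA) => // i; apply/cent1J.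
Qed.

End Pair.

Lemma lconj_is_action : is_action [set: gT] (fun a h => a ^ lmul h).
Proof.
split=> [h a b /conjg_inj // | a h k _ _]; by rewrite lmulM conjgM.
Qed.
Canonical lconj_action := Action lconj_is_action.

End Brace.

(** * The two-prime case *)

Section TwoPrimes.
Variables (X : finType) (p m : nat).
Hypotheses (p_pr : prime p) (m_pr : prime m) (neq_pm : p != m).
Hypothesis oX : #|X| = (p * m)%N.
Variables (A : {group {perm {perm X}}}) (G : {group {perm X}}).
Variable t : X -> {perm {perm X}}.
Hypothesis bAG : brace_pair A G.
Hypothesis defA : A :=: <<[set t x | x : X]>>.
Hypothesis tJ : {in G, forall h x, t x ^ lmul h = t (h x)}.
Hypothesis trG : [transitive G, on [set: X] | 'P].
Hypothesis piG : \pi(#|X|).-group G.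
Hypothesis ntN : 'O_p(G) != 1.

(* [S] is the block system of the orbits of [N], [K] the kernel of [G] on [S],
   [L] and [R] are a Sylow p-subgroup and a Sylow m-subgroup of [G]. *)
Let N := 'O_p(G)%G.
Let S := orbit 'P N @: [set: X].
Let K := 'C_G(S | ('P^* ))%G.
Let L := brace_part p A.
Let R := brace_part p^' A.
Let s x := (t x).`_p^'.

Let nNG : N <| G. Proof. exact: pcore_normal. Qed.
Let At x : t x \in A. Proof. by rewrite defA mem_gen ?imset_f. Qed.

Let transG x y : exists2 g, g \in G & y = g x.
Proof.
have [g Gg def_y] := atransP2 trG (in_setT x) (in_setT y).
by exists g; rewrite // def_y.
Qed.

Let orbNG g x : g \in G -> 'P^*%act (orbit 'P N x) g = orbit 'P N (g x).
Proof. exact: (setact_orbit_normal 'P nNG). Qed.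

Let orbN_S x : orbit 'P N x \in S. Proof. exact: imset_f. Qed.

Let orbN_ntriv x : #|orbit 'P N x| != 1%N.
Proof.
apply: contra ntN => /eqP orb1; rewrite -subG1; apply/subsetP=> n Nn.
rewrite inE; apply/eqP/permP=> y; rewrite perm1.
have orb1y : #|orbit 'P N y| = 1%N.
  have [g Gg ->] := transG x y.
  by rewrite -orbNG //= card_setact.
have /eqP/cards1P[z def_orb] := orb1y.
have := orbit_refl 'P N y; have := mem_orbit 'P y Nn.
by rewrite def_orb !inE => /eqP fix_y /eqP def_y; apply: etrans fix_y _.
Qed.

Let oN x : #|orbit 'P N x| = p.
Proof.
have p_orb : p.-nat #|orbit 'P N x|.
  by rewrite (pnat_dvd (dvdn_orbit _ _ _)) // [_.-nat _]pcore_pgroup.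
have : #|orbit 'P N x| %| p * m by rewrite -oX (card_normal_orbit nNG trG x) dvdn_mull.
rewrite Gauss_dvdl; last first.
  by rewrite (pnat_coprime p_orb) // pnatE // !inE eq_sym.
by move/(prime_nt_dvdP p_pr (orbN_ntriv x)).
Qed.

Let oS : #|S| = m.
Proof.
have /card_gt0P[x _] : 0 < #|X| by rewrite oX muln_gt0 !prime_gt0.
have /eqP := card_normal_orbit nNG trG x.
by rewrite oX oN mulnC eqn_pmul2r ?prime_gt0 // => /eqP ->.
Qed.

Let memK h : reflect (h \in G /\ forall x, orbit 'P N (h x) = orbit 'P N x) (h \in K).
Proof.
apply: (iffP setIP) => [[Gh /astabP fixS] | [Gh fixN]]; split=> //.
  by move=> x; rewrite -orbNG // fixS.
by apply/astabP=> _ /imsetP[x _ ->]; rewrite orbNG.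
Qed.

Let nKG : K <| G.
Proof.
rewrite /normal subsetIl normsI ?normG //.
exact: subset_trans (acts_normal_orbits 'P nNG) (astab_norm _ _).
Qed.

Let actsS (H : {group {perm X}}) : H \subset G -> H \subset 'N(S | 'P^* ).
Proof. by move=> sHG; apply: subset_trans sHG (acts_normal_orbits 'P nNG). Qed.

Let sLG : L \subset G. Proof. exact: pHall_sub (brace_part_Hall bAG p). Qed.
Let sRG : R \subset G. Proof. exact: pHall_sub (brace_part_Hall bAG p^'). Qed.
Let pL : p.-group L. Proof. exact: pHall_pgroup (brace_part_Hall bAG p). Qed.
Let mR : m.-group R.
Proof.
have pR : p^'.-group R by apply: pHall_pgroup (brace_part_Hall bAG p^').
have : [predI \pi(#|X|) & p^'].-nat #|R| by rewrite pnatI [_.-nat _](pgroupS sRG) //.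
apply: sub_in_pnat => r _; rewrite !inE oX primesM ?prime_gt0 // !primes_prime // !inE.
by case/andP=> /orP[-> | ->].
Qed.

Let NK : N \subset K.
Proof.
apply/subsetP=> n Nn; apply/memK; split; first exact: subsetP (pcore_sub _ _) n Nn.
by move=> x; apply/orbit_eqP; exact: (mem_orbit 'P x Nn).
Qed.

(** [s] is constant on each block, since [N] acts trivially on ['O_p^'(A)]. *)
Let sN g x : g \in N -> s (g x) = s x.
Proof.
move=> Ng; have Gg := subsetP (normal_sub nNG) g Ng.
rewrite /s -tJ // consttJ (normal_pgroup_fixes_brace bAG (pi := p) nNG) //.
  exact: pcore_sub_Hall (brace_part_Hall bAG p).
by rewrite (constt_brace bAG).
Qed.

Let s_orbN x y : orbit 'P N x = orbit 'P N y -> s x = s y.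
Proof.
move=> eq_orb; have : x \in orbit 'P N y by rewrite -eq_orb orbit_refl.
by case/orbitP=> n Nn <-; rewrite sN.
Qed.

Let fixK h a : h \in K -> a \in A -> a.`_p^' ^ lmul h = a.`_p^'.
Proof.
move=> Kh Aa; have [Gh fixN] := memK h Kh.
apply: (constt_fixes_gen bAG defA) => // x.
by rewrite -consttJ tJ //; apply: s_orbN.
Qed.

(** When [G] acts trivially on the [p^']-part of [A], the [p^']-component is a
    morphism from [G] to [A]. Its kernel [L] is then a normal p-subgroup. *)
Let L_sub_N :
    {in G, forall h, {in A, forall a, a.`_p^' ^ lmul h = a.`_p^'}} ->
  L \subset N.
Proof.
move=> fixG; apply: pcore_max; first exact: pL.
rewrite /normal sLG; apply/subsetP=> g Gg; rewrite inE; apply/subsetP=> _ /imsetP[l Ll ->].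
have Gl := subsetP sLG l Ll.
have [a Aa def_l] := brace_at1P bAG Gl.
have [b Ab def_g] := brace_at1P bAG Gg.
have [c Ac def_c] := brace_at1P bAG (groupJ Gl Gg).
have [d Ad def_d] := brace_at1P bAG (groupM Gl Gg).
have d1 : d.`_p^' = a.`_p^' * b.`_p^'.
  by rewrite (brace_constt_mul bAG p^' Aa Ab Ad) -?def_l -?def_g // -lmulV fixG // groupV.
have d2 : d.`_p^' = b.`_p^' * c.`_p^'.
  rewrite (brace_constt_mul bAG p^' Ab Ac Ad) -?def_g -?def_c -?def_d -?conjgC //.
  by rewrite -lmulV fixG // groupV.
have a1 : a.`_p^' = 1.
  apply/constt1P; rewrite p_eltNK.
  have : a \in 'O_p(A) by rewrite -(mem_brace_part bAG) -?def_l.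
  by rewrite (mem_brace_pcore bAG) => /andP[].
rewrite def_c (mem_brace_part bAG) // (mem_brace_pcore bAG) Ac -p_eltNK /=.
apply/constt1P; apply: (mulgI b.`_p^').
by rewrite -d2 d1 a1 mul1g mulg1.
Qed.

Let m_dvd_R : m %| #|R|.
Proof.
rewrite (card_Hall (brace_part_Hall bAG p^')) -(Gauss_dvdr _ (_ : coprime _ #|G|`_p)).
  have /card_gt0P[x _] : 0 < #|X| by rewrite oX muln_gt0 !prime_gt0.
  rewrite partnC // (dvdn_trans _ (_ : #|X| %| _)) // ?oX ?dvdn_mull //.
  by rewrite -oX -cardsT -(atransP trG x) // dvdn_orbit.
by rewrite coprime_sym (pnat_coprime (part_pnat _ _)) // pnatE // !inE eq_sym.
Qed.

(** [R] acts faithfully on the blocks, because an m-element has no nontrivial orbit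
    inside a block of size [p < m]; and a point stabiliser of [R] on the [m]
    blocks fixes all of them. *)
Let oR_le : p < m -> #|R| <= m.
Proof.
move=> lt_pm; have /card_gt0P[x _] : 0 < #|X| by rewrite oX muln_gt0 !prime_gt0.
rewrite -(card_orbit_stab ('P^* ) R (orbit 'P N x)).
have -> : 'C_R[orbit 'P N x | ('P^* )] = 1.
  apply/trivgP/subsetP=> h /setIP[Rh /astab1P fix_h].
  have fixS := pgroup_fix_point mR (actsS sRG) (eq_leq oS) Rh (orbN_S x) fix_h.
  rewrite inE; apply/eqP/permP=> y; rewrite perm1.
  have sHR : <[h]> \subset R by rewrite cycle_subG.
  apply: (@pgroup_small_orbit _ _ 'P m <[h]>%G y _ _ h (cycle_id h)).
    exact: pgroupS sHR mR.
  apply: leq_ltn_trans lt_pm; rewrite -(oN y) subset_leq_card //.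
  apply/subsetP=> _ /orbitP[_ /cycleP[i ->] <-].
  elim: i => [|i IHi]; first by rewrite act1 orbit_refl.
  rewrite expgSr actM -(fixS _ (orbN_S y)) /= setactE.
  exact: imset_f.
rewrite cards1 muln1 -oS subset_leq_card // acts_sub_orbit //.
exact: actsS sRG.
Qed.

(** The number of values of [s] divides [m], as [s] is a [G]-equivariant function
    of the block, and it is less than [m], as the values are nontrivial elements
    of a group of order at most [m]. Hence [s] is constant. *)
Let s_fixed : p < m -> {in G, forall h x, s x ^ lmul h = s x}.
Proof.
move=> lt_pm h Gh x.
have sJ : {in G, forall g y, s y ^ lmul g = s (g y)}.
  by move=> g Gg y; rewrite /s -consttJ tJ.
have oO : #|'O_p^'(A)| <= m.
  suff <- : #|R| = #|'O_p^'(A)| by apply: oR_le.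
  rewrite /R (brace_partE bAG) card_in_imset // => a b Oa Ob.
  by case: bAG => _ injA _ _; apply: injA; apply: (subsetP (pcore_sub p^' A)).
have s_neq1 y : s y != 1.
  apply/negP=> /eqP s_y1.
  have s1 z : s z = 1 by have [g Gg ->] := transG y z; rewrite -sJ // s_y1 conj1g.
  have : m <= #|R| by apply: dvdn_leq m_dvd_R; apply: cardG_gt0.
  suff -> : #|R| = 1%N by rewrite leqNgt prime_gt1.
  apply/eqP; rewrite -trivg_card1 (brace_partE bAG).
  apply/eqP/setP=> h'; rewrite inE; apply/imsetP/eqP=> [[a] | ->]; last first.
    by exists 1; rewrite ?group1 ?perm1.
  rewrite (mem_brace_pcore bAG) => /andP[Aa /constt_p_elt <-] ->.
  have /set1P-> : a.`_p^' \in [1 {perm {perm X}}]%G.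
    by apply: (constt_gen bAG defA) => // z; apply/set1P/s1.
  by rewrite perm1.
have lt_orb : #|orbit (lconj_action _) G (s x)| < m.
  apply: leq_trans oO; apply/proper_card/properP; split.
    apply/subsetP=> _ /orbitP[g Gg <-]; rewrite /= sJ //.
    by rewrite (constt_brace bAG).
  exists 1; rewrite ?group1 //; apply/negP=> /orbitP[g Gg] /=.
  by rewrite sJ // => /eqP; rewrite (negPf (s_neq1 _)).
have dvd_orb : #|orbit (lconj_action _) G (s x)| %| m.
  have orbS : orbit ('P^* ) G (orbit 'P N x) = S.
    exact: (atransP (atrans_normal_orbits nNG trG)).
  rewrite -oS -orbS.
  apply: dvdn_orbit_stab => g Gg; rewrite orbNG // => /s_orbN eq_s.
  by rewrite /= sJ.
have /eqP/cards1P[c def_orb] : #|orbit (lconj_action _) G (s x)| = 1%N.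
  have [_ /(_ _ dvd_orb)] := primeP m_pr; case/pred2P=> // eq_m.
  by move: lt_orb; rewrite eq_m ltnn.
have := mem_orbit (lconj_action _) (s x) Gh; have := orbit_refl (lconj_action _) G (s x).
by rewrite def_orb !inE => /eqP def_sx /eqP def_sxh; rewrite [RHS]def_sx.
Qed.

(** If [p > m], there are too few blocks for a nontrivial orbit of [L]. *)
Let LK : L \subset K.
Proof.
have [lt_pm | le_mp] := ltnP p m.
  apply: subset_trans NK; apply: L_sub_N => h Gh a Aa.
  by apply: (constt_fixes_gen bAG defA) => // x; apply: s_fixed.
apply/subsetP=> l Ll; apply/setIP; split; first exact: subsetP Ll.
apply/astabP=> B SB; apply: (pgroup_small_orbit pL) => //.
apply: (@leq_ltn_trans m); last by rewrite ltn_neqAle eq_sym neq_pm.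
by rewrite -oS subset_leq_card // acts_sub_orbit // actsS.
Qed.

Let memK_constt a : a \in A -> (a 1 \in K) = (a.`_p^' 1 \in K).
Proof.
move=> Aa; have [g Lg ->] := brace_at1_constt bAG p Aa.
by rewrite groupMr // (subsetP LK).
Qed.

(** The conjugate [a 1 ^ h] is again in [K]. Comparing [p^']-components in
    [a 1 * h = h * a 1 ^ h], where [K] acts trivially on such components, shows
    that [a 1 ^ h] has the same [p^']-component as [a ^ lmul h]; and membership
    in [K] depends on this component only. *)
Let K_lconj a h : a \in A -> a 1 \in K -> h \in G -> (a ^ lmul h) 1 \in K.
Proof.
move=> Aa Ka Gh; have Ajh : a ^ lmul h \in A by rewrite (brace_conj bAG).
have [b Ab def_h] := brace_at1P bAG Gh.
have Kc : a 1 ^ h \in K by rewrite memJ_norm // (subsetP (normal_norm nKG)).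
have [c Ac def_c] := brace_at1P bAG (subsetP (normal_sub nKG) _ Kc).
have [d Ad def_d] : exists2 d, d \in A & a 1 * h = d 1.
  by apply: (brace_at1P bAG); rewrite groupM // (brace_at1 bAG).
have d1 : d.`_p^' = a.`_p^' * b.`_p^'.
  rewrite (brace_constt_mul bAG p^' Aa Ab Ad) -?def_h // -lmulV.
  by rewrite fixK // groupV.
have d2 : d.`_p^' = b.`_p^' * c.`_p^' ^ (lmul h)^-1.
  by rewrite (brace_constt_mul bAG p^' Ab Ac Ad) -?def_h // -def_c -def_d -conjgC.
have cAA : commute a.`_p^' b.`_p^'.
  by case: bAG => /centsP cAA _ _ _; apply: cAA; rewrite groupX.
move: d1; rewrite d2 cAA => /mulgI def_a.
by rewrite memK_constt // consttJ -def_a conjgKV -memK_constt // -def_c.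
Qed.

Lemma at1_no_fixpoint x : (t x) 1 x != x.
Proof.
apply/eqP=> fix_x.
have Gu : (t x) 1 \in G by rewrite (brace_at1 bAG).
have Ku : (t x) 1 \in K.
  (* Modulo [L], which fixes all blocks, [(t x) 1] is an element of the m-group
     [R]; it fixes the block of [x], hence all [m] blocks. *)
  have [g Lg def_u] := brace_at1_constt bAG p (At x).
  set r := (t x).`_p^' 1 in def_u.
  have Rr : r \in R by rewrite (mem_brace_part bAG) ?(constt_brace bAG) // groupX.
  have Kg := subsetP LK g Lg.
  rewrite def_u groupMr //; apply/setIP; split; first exact: subsetP Rr.
  apply/astabP; apply: (pgroup_fix_point mR (actsS sRG) _ Rr (orbN_S x)); rewrite ?oS //.
  have Gr := subsetP sRG r Rr; have Gg := subsetP sLG g Lg.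
  have [_ fixg] := memK _ Kg.
  by rewrite orbNG // -fixg -permM -def_u fix_x.
have Kt y : (t y) 1 \in K.
  by have [g Gg ->] := transG x y; rewrite -(tJ Gg) (K_lconj (At x) Ku Gg).
pose W := [set a in A | a 1 \in K].
have gW : group_set W.
  apply/group_setP; split; first by apply/setIdP; rewrite perm1 !group1.
  move=> a b /setIdP[Aa Ka] /setIdP[Ab Kb]; apply/setIdP; split; first exact: groupM.
  by rewrite mul_at1; apply: groupM Ka (K_lconj Ab Kb (brace_at1 bAG Aa)).
have sGK : G \subset K.
  apply/subsetP=> g /(brace_at1P bAG)[a Aa ->].
  suff /subsetP/(_ a) : <<[set t y | y : X]>> \subset Group gW.
    by rewrite -defA => /(_ Aa)/setIdP[].
  rewrite gen_subG; apply/subsetP=> _ /imsetP[y _ ->].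
  by apply/setIdP; split; [apply: At | apply: Kt].
have S1 : #|S| <= 1.
  apply/card_le1_eqP=> _ _ /imsetP[y _ ->] /imsetP[z _ ->].
  by have [g Gg ->] := transG z y; have [_ ->] := memK _ (subsetP sGK g Gg).
by move: S1; rewrite oS leqNgt prime_gt1.
Qed.

End TwoPrimes.

(** * Reduction to the primes dividing the degree *)

Lemma solvable_pcore_ntriv (gT : finGroupType) (G : {group gT}) :
  solvable G -> G :!=: 1 -> exists2 p, p \in \pi(G) & 'O_p(G) != 1.
Proof.
move=> solG ntG.
have [M minM sMG] := minnormal_exists ntG (normG G).
have [nMG ntM /is_abelemP[p p_pr /abelem_pgroup pM]] := minnormal_solvable minM sMG solG.
exists p.
  have [_ p_dvd_M _] := pgroup_pdiv pM ntM.
  by rewrite mem_primes p_pr cardG_gt0 (dvdn_trans p_dvd_M) ?cardSg.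
apply: contra ntM => /eqP O1; rewrite -subG1 -O1 pcore_max //.
exact/andP.
Qed.

Section Reduction.
Variables (X : finType) (p q : nat).
Hypotheses (p_pr : prime p) (q_pr : prime q) (neq_pq : p != q).
Hypothesis oX : #|X| = (p * q)%N.
Variables (A : {group {perm {perm X}}}) (G : {group {perm X}}).
Variable t : X -> {perm {perm X}}.
Hypothesis bAG : brace_pair A G.
Hypothesis defA : A :=: <<[set t x | x : X]>>.
Hypothesis tJ : {in G, forall h x, t x ^ lmul h = t (h x)}.
Hypothesis trG : [transitive G, on [set: X] | 'P].

Let pi : nat_pred := \pi(#|X|).

(** Passing to the [pi]-parts of [A] and of [G] preserves all the hypotheses. In
    particular the Hall subgroup [H] stays transitive, because [#|X|] is a
    [pi]-number. *)
Lemma constt_at1_no_fixpoint x : (t x).`_pi 1 x != x.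
Proof.
have At y : t y \in A by rewrite defA mem_gen ?imset_f.
pose H := brace_part pi A; pose B := ('O_pi(A))%G.
have bBH : brace_pair B H by apply: (brace_part_pair bAG).
have hallH : pi.-Hall(G) H by apply: (brace_part_Hall bAG).
have sHG := pHall_sub hallH.
have defB : B :=: <<[set (t y).`_pi | y : X]>>.
  apply/eqP; rewrite eqEsubset gen_subG; apply/andP; split; last first.
    by apply/subsetP=> _ /imsetP[y _ ->]; rewrite (constt_brace bAG).
  apply/subsetP=> a; rewrite (mem_brace_pcore bAG) => /andP[Aa /constt_p_elt <-].
  apply: (constt_gen (H := <<_>>%G) bAG defA) => // y.
  by apply: mem_gen; apply: (imset_f (fun y => (t y).`_pi)).
have oXG : (#|X| * #|'C_G[x | 'P]| = #|G|)%N.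
  by rewrite -(card_orbit_stab 'P G x) (atransP trG x (in_setT x)) cardsT.
have piX : pi.-nat #|X| by rewrite pnat_pi // oX muln_gt0 !prime_gt0.
(* Counting [H] by its orbit of [x] shows that this orbit has [#|X| * k] points,
   so that [k = 1]. *)
have /dvdnP[k def_k] : #|'C_H[x | 'P]| %| #|'C_G[x | 'P]|`_pi.
  rewrite -(part_pnat_id (pgroupS (subsetIl _ _) (pHall_pgroup hallH))).
  by rewrite partn_dvd ?cardG_gt0 // cardSg ?setSI.
have oH : #|orbit 'P H x| = (#|X| * k)%N.
  apply/eqP; rewrite -(eqn_pmul2r (cardG_gt0 'C_H[x | 'P])) card_orbit_stab.
  rewrite (card_Hall hallH) -oXG partnM ?cardG_gt0 ?(part_pnat_id piX) ?def_k ?mulnA //.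
  by case/andP: piX.
have X_gt1 : 1 < #|X|.
  by rewrite oX (leq_trans (prime_gt1 p_pr)) // leq_pmulr ?prime_gt0.
have trH : [transitive H, on [set: X] | 'P].
  apply/imsetP; exists x => //; apply/esym/eqP; rewrite eqEcard subsetT /= cardsT oH.
  rewrite leq_pmulr // lt0n; apply/eqP=> k0; have := orbit_refl 'P H x.
  by rewrite (cards0_eq (_ : #|orbit 'P H x| = 0)) ?inE // oH k0 muln0.
have ntH : H :!=: 1.
  apply: contraL X_gt1 => /eqP H1; rewrite -leqNgt -cardsT -(atransP trH x (in_setT x)).
  by rewrite dvdn_leq // (dvdn_trans (dvdn_orbit _ _ _)) // H1 cards1.
have piH : pi.-group H by apply: pHall_pgroup hallH.
have pi_pq : pi =i [:: p; q].
  by move=> r; rewrite /pi oX !inE primesM ?prime_gt0 // !primes_prime // !inE.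
have solH : solvable H.
  apply: Burnside_p_a_q_b.
  rewrite (@uniq_leq_size _ _ [:: p; q]) ?primes_uniq // => r r_piH.
  by rewrite -pi_pq (pnatPpi piH).
have tJH : {in H, forall h y, (t y).`_pi ^ lmul h = (t (h y)).`_pi}.
  by move=> h Hh y; rewrite -consttJ tJ // (subsetP sHG).
have [l pi_l ntO] := solvable_pcore_ntriv solH ntH.
have := pnatPpi piH pi_l; rewrite pi_pq !inE => /orP[] /eqP def_l.
  by apply: (at1_no_fixpoint p_pr q_pr neq_pq oX bBH defB tJH trH piH); rewrite -def_l.
apply: (at1_no_fixpoint q_pr p_pr _ _ bBH defB tJH trH piH); rewrite -?def_l //.
  by rewrite def_l eq_sym.
by rewrite oX def_l mulnC.
Qed.

End Reduction.

(** * The brace of a solution *)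

Section PermutationBrace.
Variables (X : finType) (r : solution X).
Implicit Types (x y : X) (g h : {perm X}).

Definition sigma_perm x : {perm X} := perm (bij_inj (sol_sigma_bij r x)).
Definition rho x : {perm X} := (sigma_perm x)^-1.

Lemma sigma_permE x y : sigma_perm x y = sigma r x y. Proof. exact: permE. Qed.
Lemma rho_sigma x y : rho x (sigma r x y) = y.
Proof. by rewrite -sigma_permE permK. Qed.
Lemma sigma_rho x y : sigma r x (rho x y) = y.
Proof. by rewrite -sigma_permE permKV. Qed.

Lemma solE x y : r (x, y) = (sigma r x y, tau r y x).
Proof. exact: surjective_pairing. Qed.

Lemma tau_rho x y : tau r y x = rho (sigma r x y) x.
Proof.
have := sol_involutive r (x, y); rewrite solE solE => -[eqx _].
by apply: (bij_inj (sol_sigma_bij r (sigma r x y))); rewrite sigma_rho.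
Qed.

(** The first component of the braid relation, taken at [(x, rho x y, z)],
    gives the cycle set identity for the operation [rho]. *)
Lemma rho_cycle x y : rho x * rho (rho x y) = rho y * rho (rho y x).
Proof.
apply: invg_inj; rewrite !invMg !invgK; apply/permP=> z; rewrite !permM !sigma_permE.
have := sol_braided r (x, rho x y, z).
do 4!rewrite /r1 /r2 ?(solE, sigma_rho, tau_rho) /=.
by case.
Qed.

Definition diag_inv x := rho x x.

Lemma diag_mapK x : diag_inv (diag_map r x) = x.
Proof.
rewrite permE; set y := diag_fun r x.
have tau_y : tau r x y = x by apply: f_invF.
have sig_y : sigma r y x = y.
  apply: (bij_inj (sol_tau_bij r x)); rewrite tau_y.
  have := sol_involutive r (y, x); rewrite solE tau_y solE => -[_ ->].
  by [].
by rewrite /diag_inv -{2}sig_y rho_sigma.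
Qed.

Lemma diag_invE : diag_inv =1 (diag_map r)^-1.
Proof. by move=> x; rewrite -{1}(permKV (diag_map r) x) diag_mapK. Qed.

Lemma diag_inv_inj : injective diag_inv.
Proof. exact: eq_inj perm_inj (fsym diag_invE). Qed.

Definition perm_group : {group {perm X}} := <<[set rho x | x : X]>>%G.
Local Notation G := perm_group.

Lemma rho_G x : rho x \in G. Proof. by rewrite mem_gen ?imset_f. Qed.

(** Addition of the brace element attached to [x]. It is only meaningful on [G];
    letting it be the identity elsewhere makes the action of [A] on [G]
    faithful. *)
Definition add_rho_fun x g := if g \in G then g * rho (g x) else g.

Lemma add_rho_fun_G x g : (add_rho_fun x g \in G) = (g \in G).
Proof.
by rewrite /add_rho_fun; case: ifP => [Gg|->//]; rewrite groupM ?rho_G.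
Qed.

(** The value at [x] of [g * rho (g x)] is [diag_inv (g x)], which determines
    [g x] and thus [g]. *)
Lemma add_rho_inj x : injective (add_rho_fun x).
Proof.
move=> g h eq_gh; have := congr1 (fun k => k \in G) eq_gh; rewrite !add_rho_fun_G => eqG.
move: eq_gh; rewrite /add_rho_fun -eqG; case: ifP => // _ eq_gh.
have := congr1 (fun k : {perm X} => k x) eq_gh; rewrite !permM => /diag_inv_inj eqx.
by move: eq_gh; rewrite eqx => /mulIg.
Qed.

Definition add_rho x : {perm {perm X}} := perm (@add_rho_inj x).

Lemma add_rhoE x g : g \in G -> add_rho x g = g * rho (g x).
Proof. by move=> Gg; rewrite permE /add_rho_fun Gg. Qed.

Lemma add_rho_out x g : g \notin G -> add_rho x g = g.
Proof. by move=> Gg; rewrite permE /add_rho_fun (negPf Gg). Qed.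

Lemma add_rho_G x g : (add_rho x g \in G) = (g \in G).
Proof. by rewrite permE add_rho_fun_G. Qed.

Lemma add_rhoC x y : commute (add_rho x) (add_rho y).
Proof.
apply/permP=> g; rewrite !permM.
have [Gg | nGg] := boolP (g \in G); last by rewrite !add_rho_out.
rewrite !add_rhoE ?groupM ?rho_G // -!mulgA !permM; congr (g * _).
exact: rho_cycle.
Qed.

Lemma add_rhoJ x h : h \in G -> add_rho x ^ lmul h = add_rho (h x).
Proof.
move=> Gh; apply/permP=> g; rewrite conj_lmulE.
have [Gg | nGg] := boolP (g \in G).
  by rewrite !add_rhoE ?groupM // permM -mulgA mulKg.
by rewrite !add_rho_out ?groupMl // mulKg.
Qed.

(** The brace multiples of the element attached to [x] follow the diagonal map. *)
Lemma add_rhoX_diag x n : ((add_rho x ^+ n) 1) x = iter n diag_inv x.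
Proof.
have inG k : (add_rho x ^+ k) 1 \in G.
  by elim: k => [|k IHk]; rewrite ?perm1 ?group1 // expgSr permM add_rho_G.
elim: n => [|n IHn]; first by rewrite !perm1.
by rewrite expgSr permM add_rhoE // permM iterS -IHn.
Qed.

Definition add_group : {group {perm {perm X}}} := <<[set add_rho x | x : X]>>%G.
Local Notation A := add_group.

(** [A] is transitive on [G] because right multiplication by [rho x] at [g] is the
    addition of the element attached to [g^-1 x]; an abelian transitive group is
    regular. *)
Lemma add_group_brace : brace_pair A G.
Proof.
have cAA : abelian A.
  rewrite abelian_gen; apply/centsP=> _ /imsetP[x _ ->] _ /imsetP[y _ ->].
  exact: add_rhoC.
have AG a : a \in A -> a \in 'N(G | 'P).
  apply/subsetP; rewrite gen_subG; apply/subsetP=> _ /imsetP[x _ ->].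
  by apply/astabsP=> g; apply: add_rho_G.
have Aout a : a \in A -> a \in 'C(~: G | 'P).
  apply/subsetP; rewrite gen_subG; apply/subsetP=> _ /imsetP[x _ ->].
  by apply/astabP=> g; rewrite inE; apply: add_rho_out.
have A1 g : g \in G -> exists2 a, a \in A & a 1 = g.
  case/gen_prodgP=> n [c Rc ->].
  elim: n c Rc => [|n IHn] c Rc; first by exists 1; rewrite ?group1 ?perm1 ?big_ord0.
  rewrite big_ord_recr /=.
  have [i|a Aa def_a] := IHn (fun i => c (widen_ord (leqnSn n) i)); first exact: Rc.
  have /imsetP[x _ ->] := Rc ord_max.
  exists (a * add_rho ((a 1)^-1 x)); first by rewrite groupM // mem_gen // imset_f.
  by rewrite permM add_rhoE ?permKV ?def_a // -def_a (astabsP (AG a Aa) 1) group1.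
split=> //.
- move=> a b Aa Ab eq1; apply/permP=> g.
  have [/A1[c Ac <-] | nGg] := boolP (g \in G); last first.
    rewrite -[a g]/('P%act g a) -[b g]/('P%act g b).
    by rewrite !(astabP (Aout _ _)) // inE.
  by rewrite -!permM (centsP cAA c Ac a) // (centsP cAA c Ac b) // !permM eq1.
- apply/setP=> g; apply/imsetP/idP=> [[a Aa ->] | /A1[a Aa <-]]; last by exists a.
  by have := astabsP (AG a Aa) 1; rewrite group1.
move=> h Gh; rewrite inE -genJ gen_subG; apply/subsetP=> _ /imsetP[a /imsetP[x _ ->] ->].
by rewrite add_rhoJ // mem_gen // imset_f.
Qed.

(** Both components of [r (x, y)] are obtained from [x] and [y] by elements of [G]
    or their inverses, so an orbit and its complement would decompose [r]. *)
Lemma perm_group_trans : indecomposable r -> [transitive G, on [set: X] | 'P].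
Proof.
move=> indec; have /card_gt0P[x0 _] : 0 < #|X| by apply: ltnW (sol_card_gt1 r).
apply/imsetP; exists x0 => //; set Y := orbit 'P G x0.
apply/eqP/negPn/negP=> neqY; apply: indec; exists Y, (~: Y).
have stab (Z : {set X}) : (forall x z, (rho x z \in Z) = (z \in Z)) ->
    r @: setX Z Z = setX Z Z.
  move=> ZP; apply/eqP; rewrite eqEcard card_imset ?leqnn ?andbT; last first.
    exact: inv_inj (sol_involutive r).
  apply/subsetP=> _ /imsetP[[x y] /setXP[Zx Zy] ->]; rewrite solE.
  by apply/setXP; rewrite /= -(ZP x) rho_sigma tau_rho ZP.
have YP x z : (rho x z \in Y) = (z \in Y).
  exact: (orbit_actr 'P x0 z (rho_G x)).
split; last by split; apply: stab => x z; rewrite ?inE YP.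
split.
- by apply/set0Pn; exists x0; apply: orbit_refl.
- apply: contra neqY => /eqP Y0; by rewrite -[Y]setCK Y0 setC0.
- by rewrite -setI_eq0 setICr.
- exact: setUCr.
Qed.

End PermutationBrace.

(** * Lengths of the orbits of the diagonal map *)

Lemma diag_orbit_not_coprime (X : finType) (r : solution X) (p q : nat) (x : X) :
    prime p -> prime q -> p != q -> indecomposable r -> #|X| = (p * q)%N ->
  ~~ coprime #|X| #|porbit (diag_map r) x|.
Proof.
move=> p_pr q_pr neq_pq indec oX; set n := #|_|.
apply/negP=> co_n; pose pi : nat_pred := \pi(#|X|).
have /negP[] := constt_at1_no_fixpoint p_pr q_pr neq_pq oX (add_group_brace r)
  (erefl _) (fun h Gh y => add_rhoJ y Gh) (perm_group_trans indec) x.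
set a := add_rho r x; rewrite -/pi.
(* [n] is prime to the order of the pi-element [a.`_pi]. *)
have /cycleP[k def_a] : a.`_pi \in <[a ^+ n]>.
  have gen_a : <[a.`_pi]> = <[a.`_pi ^+ n]>.
    apply/eqP; rewrite -[_ == _]/(generator _ _) generator_coprime.
    apply: (pnat_coprime (p_elt_constt pi a)).
    have n_gt0 : 0 < n by apply/card_gt0P; exists x; apply: porbit_id.
    by rewrite -coprime_pi' // oX muln_gt0 !prime_gt0.
  have: a.`_pi \in <[a.`_pi ^+ n]> by rewrite -gen_a cycle_id.
  by rewrite -consttX => /cycleP[k ->]; rewrite groupX ?cycle_constt.
have fix_n i : iter (n * i) (diag_inv r) x = x.
  rewrite (eq_iter (diag_invE r)) -permX.
  have fixT : (diag_map r ^+ n) x = x by rewrite permX iter_porbit.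
  have fix_Ti : (diag_map r ^+ (n * i)) x = x.
    by rewrite expgM permX; elim: i => //= i ->.
  by rewrite expgVn; apply: (perm_inj (s := diag_map r ^+ (n * i))); rewrite permKV.
by rewrite def_a -expgM add_rhoX_diag fix_n.
Qed.

Local Close Scope group_scope.

Theorem theorem3 (X : finType) (r : solution X) (p q : nat)
    (p_prime : prime p) (q_prime : prime q) (p_neq_q : p <> q)
    (r_indecomposable : indecomposable r) (X_card : #|X| = p * q) :
  ~ exists s : nat,
      [/\ s \in T_partition r, (p - 1) * q < s, s < p * q & gcdn s p = 1].
Proof.
case=> s [Ts lt_s s_lt co_sp].
move: Ts; rewrite mem_sort => /mapP[B]; rewrite mem_enum => /imsetP[x _ ->] def_s.
have := diag_orbit_not_coprime x p_prime q_prime _ r_indecomposable X_card.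
rewrite -def_s X_card coprimeMl [coprime p s]coprime_sym /coprime co_sp eqxx /=.
move=> /(_ (introN eqP p_neq_q)); rewrite -/(coprime q s) prime_coprime // negbK.
case/dvdnP=> k def_k; move: lt_s s_lt; rewrite def_k !ltn_pmul2r ?prime_gt0 //.
by rewrite subn1 prednK ?prime_gt0 // leqNgt => /negP.
Qed.
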